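(* Let $(V,d)$ be a complete metric space, $G$ an open subset of $V$, $f:G\to V$ a map that is nonexpansive with respect to $d$ (i.e. $d(f(x),f(y))\le d(x,y)$ for all $x,y\in G$), and $v\in G$ a fixed point of $f$: $f(v)=v$. Assume the following about $(V,d)$ and $v$: (B1) There exists a real Banach space $(E,\|\cdot\|_E)$ such that $V$ is an open subset of $E$, and such that for any $U\subset V$, $U$ is open in the $d$-metric topology if and only if it is open in the norm topology of $E$. In addition, for every $\lambda>1$ there exists a neighborhood $U$ of $v$ in $(V,d)$ such that $\lambda^{-1}\|x-y\|_E\le d(x,y)\le \lambda\|x-y\|_E$ for all $x,y\in U$. (B2) The balls $B(x,\rho)=\{y\in V\mid d(y,x)\le\rho\}$ of $(V,d)$ are convex in $E$. (B3) For all $w\in V$ and $s\in(0,1)$, the set $\{z\in V\mid d(z,v)=s\,d(v,w),\ d(z,w)=(1-s)\,d(v,w)\}$ is nonempty. Assume moreover: (A1) $f:G\to E$ is semidifferentiable at $v$, with semidifferential $f'_v:E\to E$; (A2) the map $\mathrm{Id}-f'_v:E\to E$ has Property (F); (A3) the fixed point of $f'_v$ is unique: if $x\in E$ and $f'_v(x)=x$ then $x=0$. Then the fixed point of $f$ in $G$ is unique: if $w\in G$ and $f(w)=w$, then $w=v$.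
   Context: Semidifferentiability: let $X,Y$ be normed spaces, $G\subset X$, and $v$ an interior point of $G$. A map $f:G\to Y$ is semidifferentiable at $v$ if there exists a continuous, positively homogeneous map $h:X\to Y$ (i.e. $h(tx)=th(x)$ for all $t>0$, $x\in X$) such that $f(v+x)=f(v)+h(x)+o(\|x\|)$ as $x\to0$. Such $h$ is unique; it is called the semidifferential of $f$ at $v$ and denoted $f'_v$. Property (F): if $X,Y$ are Banach spaces and $D\subset X$, a map $g:D\to Y$ has Property (F) if every sequence $(x_j)_{j\ge1}$ in $D$ that is bounded in $X$ and satisfies $g(x_j)\to0$ has a subsequence that converges in $X$. *)

(* Defs.v *)
From HB Require Import structures.
From mathcomp Require Import all_boot all_order all_algebra.
From mathcomp Require Import all_classical all_reals all_analysis.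

Set Implicit Arguments.
Unset Strict Implicit.
Unset Printing Implicit Defensive.

Import Order.TTheory GRing.Theory Num.Theory.
Import numFieldNormedType.Exports.

Local Open Scope classical_set_scope.
Local Open Scope ring_scope.

(* Only the values of d on V matter. *)
Definition metric_on (R : realType) (T : choiceType) (V : set T)
    (d : T -> T -> R) : Prop :=
  [/\ forall x, V x -> d x x = 0,
      forall x y, V x -> V y -> d x y = 0 -> x = y,
      forall x y, V x -> V y -> d x y = d y x &
      forall x y z, V x -> V y -> V z -> d x z <= d x y + d y z].

(* The metric space (V, d). It is a record and not set_type V because the latter
   carries, for V a set of a topological space, the topology induced by that
   space, which must not be confused with the d-metric topology. *)
Record metric_space (R : realType) (T : choiceType) (V : set T)
    (d : T -> T -> R) (hd : metric_on V d) :=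
  MetricPoint { point_val : T; point_valP : point_val \in V }.

Section metric_space_instances.
Context (R : realType) (T : choiceType) (V : set T) (d : T -> T -> R).
Context (hd : metric_on V d).
Local Notation M := (metric_space hd).

HB.instance Definition _ := [isSub for @point_val R T V d hd].
HB.instance Definition _ := [Choice of M by <:].

Let dist (x y : M) : R := d (\val x) (\val y).

Let inV (x : M) : V (\val x). Proof. exact: set_mem (point_valP x). Qed.

Let distxx x : dist x x = 0.
Proof. by have [d0 _ _ _] := hd; apply: d0. Qed.

Let dist_positivity x y : dist x y = 0 -> x = y.
Proof. by have [_ d1 _ _] := hd => /d1 xy; apply: val_inj; apply: xy. Qed.

Let dist_sym x y : dist x y = dist y x.
Proof. by have [_ _ d2 _] := hd; apply: d2. Qed.

Let dist_triangle y x z : dist x z <= dist x y + dist y z.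
Proof. by have [_ _ _ d3] := hd; apply: d3. Qed.

HB.instance Definition _ := isMetric.Build R M
  distxx dist_positivity dist_sym dist_triangle.

Lemma metric_space_mdistE (x y : M) : mdist x y = d (\val x) (\val y).
Proof. by []. Qed.

Definition metric_point (x : T) (Vx : V x) : M := MetricPoint hd (mem_set Vx).

(* U seen as a subset of (V, d); used for U included in V. *)
Definition metric_set (U : set T) : set M := [set x | U (\val x)].

Definition metric_open (U : set T) : Prop := open (metric_set U).

(* The library's completeness axiom; [cvg F] is spelled out as it is only available
   for pointed spaces. *)
Definition metric_complete : Prop :=
  forall F : set_system M, ProperFilter F -> cauchy F ->
    exists x : M, F --> x.

Definition metric_cball (x : T) (rho : R) : set T :=
  [set y | V y /\ d y x <= rho].

End metric_space_instances.
Arguments metric_cball {R T} V d x rho.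

Definition nonexpansive_on (R : realType) (T : Type) (d : T -> T -> R)
    (G : set T) (f : T -> T) : Prop :=
  forall x y, G x -> G y -> d (f x) (f y) <= d x y.

Definition positively_homogeneous (R : realType) (X Y : lmodType R)
    (h : X -> Y) : Prop :=
  forall (t : R) (x : X), 0 < t -> h (t *: x) = t *: h x.

(* A map G -> Y is given by a total function f : X -> Y. Since v is interior to
   G, the expansion at v does not depend on the values of f outside G. *)
Definition is_semidifferential (R : realType) (X Y : normedModType R)
    (G : set X) (f : X -> Y) (v : X) (h : X -> Y) : Prop :=
  [/\ interior G v, continuous h, positively_homogeneous h &
      (fun x => f (v + x)) = (fun x => f v + h x) +o_ (0 : X) id].

Definition property_F (R : realType) (X Y : completeNormedModType R)
    (D : set X) (g : X -> Y) : Prop :=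
  forall x : nat -> X,
    (forall j, D (x j)) -> bounded_fun x -> g (x j) @[j --> \oo] --> (0 : Y) ->
    exists2 phi : nat -> nat, {homo phi : i j / (i < j)%N} &
      cvgn (fun j => x (phi j)).

(* Main.v *)
(* If [w <> v] is another fixed point, the set [C] of points at distance at most
   [s d(v,w)] from [v] and [(1 - s) d(v,w)] from [w] is nonempty, convex, closed in
   the norm and [f]-invariant, and by the triangle inequality it lies on the sphere
   of radius [s d(v,w)] around [v]. For small [s] the map [f] is [l^2]-Lipschitz on
   [C] for the norm, with [l] near 1, so perturbing it into a contraction yields a
   point [z] of [C] with [f z - z] small relative to [z - v]. By
   semidifferentiability [x := z - v] is an almost fixed point of [h]; normalizing
   and applying Property (F) gives a unit fixed point of [h]. *)
From HB Require Import structures.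
Require Import Defs.
From mathcomp Require Import all_boot all_order all_algebra.
From mathcomp Require Import all_classical all_reals all_analysis.
From mathcomp Require Import lra.

Set Implicit Arguments.
Unset Strict Implicit.
Unset Printing Implicit Defensive.

Import Order.TTheory GRing.Theory Num.Theory.
Import numFieldNormedType.Exports.

Local Open Scope classical_set_scope.
Local Open Scope ring_scope.

Section metric_space_topology.
Context (R : realType) (T : choiceType) (V : set T) (d : T -> T -> R).
Context (hd : metric_on V d).

Lemma metric_on_ge0 x y : V x -> V y -> 0 <= d x y.
Proof.
have [d0 _ ds dt] := hd => Vx Vy.
by have := dt x y x Vx Vy Vx; rewrite d0// (ds y x)//; lra.
Qed.

Lemma nbhs_metric_point x (Vx : V x) (A : set (metric_space hd)) :
  nbhs (metric_point hd Vx) A ->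
  exists2 e, 0 < e & forall y (Vy : V y), d x y < e -> A (metric_point hd Vy).
Proof.
move=> /nbhs_ballP[e e0 eA]; exists e => // y Vy xy.
by apply: eA; rewrite ballEmdist.
Qed.

Lemma metric_open_ball (A : set T) x : V x -> metric_open hd A -> A x ->
  exists2 e, 0 < e & forall y, V y -> d x y < e -> A y.
Proof.
move=> Vx; rewrite /metric_open openE => oA Ax.
have [e e0 eA] := nbhs_metric_point (oA (metric_point hd Vx) Ax).
by exists e.
Qed.

(** The complement is taken inside [V] because [B1_topology] compares only subsets of [V]; this is
    how [d]-balls yield norm-closed sets. *)
Lemma metric_open_setD_cball x rho : V x ->
  metric_open hd (V `\` metric_cball V d x rho).
Proof.
have [_ _ _ dt] := hd => Vx.
rewrite /metric_open openE => y [Vy Cy].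
have {Cy} rhoy : rho < d (\val y) x.
  by rewrite ltNge; apply/negP => yrho; apply: Cy.
apply/nbhs_ballP; exists (d (\val y) x - rho); first by rewrite /= subr_gt0.
move=> z; rewrite ballEmdist/= metric_space_mdistE => yz.
have Vz : V (\val z) by exact: set_mem (point_valP z).
split=> // -[_ zrho].
by have := dt _ _ _ Vy Vz Vx; lra.
Qed.

End metric_space_topology.

Section almost_fixed_points.
Context (R : realType) (E : completeNormedModType R).

(* The fixed point of the contraction [z |-> t p + (1 - t) f z]. *)
Lemma lipschitz_almost_fixed_point (C : set E) (f : E -> E) (k t : R) (p : E) :
  closed C -> convex_set C -> {homo f : x / C x} ->
  (forall x y, C x -> C y -> `|f x - f y| <= k * `|x - y|) ->
  0 < t < 1 -> 0 <= k -> (1 - t) * k < 1 -> C p ->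
  exists2 z, C z & f z - z = t *: (f z - p).
Proof.
move=> clC cvC fC fk /andP[t0 t1] k0 tk1 Cp.
pose g z := t *: p + (1 - t) *: f z.
have gC : set_fun C C g.
  move=> z Cz; have ti : Itv.spec (@Itv.num_sem R) (Itv.Real `[0%Z, 1%Z]) t.
    by rewrite /= /Itv.num_sem /= !num_real /= in_itv /= !ltW.
  have := cvC p (f z) (Itv.mk ti) (mem_set Cp) (mem_set (fC _ Cz)).
  by move/set_mem.
pose gF : {fun C >-> C} := HB.pack g (isFun.Build _ _ _ _ g gC).
have q0 : 0 <= (1 - t) * k by apply: mulr_ge0 => //; lra.
have ctr : is_contraction gF.
  exists (NngNum q0); split=> //= -[x y] /= [Cx Cy].
  rewrite /g opprD addrACA subrr add0r -scalerBr normrZ ger0_norm; last lra.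
  by rewrite -mulrA ler_wpM2l ?fk//; lra.
have [|z Cz zE] := banach_fixed_point ctr clC; first by exists p.
exists z => //.
(* Only the subtracted [z] is expanded, as [t p + (1 - t) f z]. *)
rewrite [in X in _ - X]zE /= /g scalerBr scalerBl scale1r opprD opprB.
by rewrite addrCA [X in _ + X]addrC subrK addrC.
Qed.

(** Homogeneity lets almost fixed points be scaled to norm 1, with errors tending to 0. A
    subsequence converges by Property (F); its limit still has norm 1, and is fixed by continuity of
    [h]. *)
Lemma property_F_fixed_point (h : E -> E) :
  continuous h -> positively_homogeneous h ->
  property_F [set: E] (fun x => x - h x) ->
  (forall e, 0 < e -> exists2 x, x != 0 & `|h x - x| <= e * `|x|) ->
  exists2 x, x != 0 & h x = x.
Proof.
move=> ch ph FF almost.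
have unit_almost n : exists x : E, `|x| = 1 /\ `|x - h x| <= harmonic n.
  have [|x x0 hx] := almost (harmonic n : R); first exact: harmonic_gt0.
  have nx : 0 < `|x| by rewrite normr_gt0.
  exists (`|x|^-1 *: x); split.
    by rewrite normrZ normfV normr_id mulVf ?gt_eqF.
  rewrite ph ?invr_gt0// -scalerBr normrZ normfV normr_id distrC.
  by rewrite ler_pdivrMl// mulrC.
have [x xP] := choice unit_almost.
have xh0 : x n - h (x n) @[n --> \oo] --> (0 : E).
  apply/cvgr0Pnorm_lt => e e0.
  have /cvgr0Pnorm_lt/(_ e e0) := @cvg_harmonic R.
  apply: filterS => n /=; apply: le_lt_trans.
  by rewrite (le_trans (xP n).2)// ler_norm.
have [||phi phi_mono /cvg_ex[/= l xl]] := FF x _ _ xh0.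
- by [].
- exists 1; split; first exact: num_real.
  by move=> M M1 n _ /=; rewrite (xP n).1 ltW.
have nl : `|l| = 1.
  have : `|x (phi n)| @[n --> \oo] --> `|l| by exact: cvg_norm.
  under eq_fun do rewrite (xP _).1.
  by move/cvg_lim => <- //; rewrite lim_cst.
exists l; first by rewrite -normr_gt0 nl.
have phioo : phi n @[n --> \oo] --> \oo.
  have phi_ge n : (n <= phi n)%N.
    by elim: n => // n ih; apply: leq_ltn_trans ih _; exact: phi_mono.
  apply/cvgnyPge => A; near=> n; apply: leq_trans (phi_ge n).
  by near: n; exact: nbhs_infty_ge.
have hl : x (phi n) - h (x (phi n)) @[n --> \oo] --> l - h l.
  by apply: cvgB => //; apply: continuous_cvg => //; exact: ch.
have hl0 : x (phi n) - h (x (phi n)) @[n --> \oo] --> (0 : E).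
  exact: (cvg_comp phi (fun n => x n - h (x n)) phioo xh0).
by apply/esym/eqP; rewrite -subr_eq0; apply/eqP; exact: cvg_unique hl hl0.
Unshelve. all: end_near. Qed.

End almost_fixed_points.

Theorem theorem6p1 (R : realType) (E : completeNormedModType R)
  (V : set E) (d : E -> E -> R) (hd : metric_on V d)
  (V_complete : metric_complete hd)
  (G : set E) (GV : G `<=` V) (G_open : metric_open hd G)
  (f : E -> E) (f_GV : forall x, G x -> V (f x))
  (f_nonexp : nonexpansive_on d G f)
  (v : E) (Gv : G v) (fv : f v = v)
  (B1_open : open V)
  (B1_topology : forall U : set E, U `<=` V -> (metric_open hd U <-> open U))
  (B1_metric : forall lambda : R, 1 < lambda ->
    exists2 U : set (metric_space hd),
      nbhs (metric_point hd (GV v Gv)) U &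
      forall x y, U x -> U y ->
        lambda^-1 * `|\val x - \val y| <= d (\val x) (\val y)
          <= lambda * `|\val x - \val y|)
  (B2 : forall (x : E) (rho : R), V x -> convex_set (metric_cball V d x rho))
  (B3 : forall (w : E) (s : R), V w -> 0 < s < 1 ->
    exists z : E,
      [/\ V z, d z v = s * d v w & d z w = (1 - s) * d v w])
  (h : E -> E) (A1 : is_semidifferential G f v h)
  (A2 : property_F [set: E] (fun x => x - h x))
  (A3 : forall x : E, h x = x -> x = 0) :
  forall w : E, G w -> f w = w -> w = v.
Proof.
have [_ d1 ds dt] := hd; have Vv := GV _ Gv.
have [_ ch ph ho] := A1.
move=> w Gw fw; apply: contrapT => wv; have Vw := GV _ Gw.
suff [x x0 hx] : exists2 x, x != 0 & h x = x.
  by move/eqP: x0; apply; exact: A3.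
apply: property_F_fixed_point => // e e0.
(* The final error is at most [9 t]: [8 t] from the perturbation into a contraction and [t] from the
   semidifferential. *)
pose t : R := Num.min 2^-1 (e / 9).
have t0 : 0 < t by rewrite lt_min; apply/andP; split; [lra|exact: divr_gt0].
have t1 : t <= 2^-1 by rewrite ge_min lexx.
have te : 9 * t <= e by rewrite -ler_pdivlMl// mulrC ge_min lexx orbT.
(* Close enough to 1 that [(1 - t) * l ^ 2 < 1]. *)
pose l := 1 + t / 4.
have [|U nU dU] := B1_metric l; first by rewrite /l; lra.
have [e1 e1_0 e1U] := nbhs_metric_point nU.
(* Besides controlling the remainder, this closed ball inside [V] serves to prove [C] closed in
   [E]. *)
have [r rP] : exists r : {posnum R}, closed_ball v r%:num `<=`
    V `&` [set y | `|f y - v - h (y - v)| <= t * `|y - v|].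
  apply/nbhs_closedballP; apply: filterI; first exact: open_nbhs_nbhs.
  have /eqaddoP/(_ t t0) fo := ho.
  have yv : (y - v) @[y --> v] --> (0 : E).
    rewrite -[X in _ --> X](subrr v).
    by apply: cvgB; [exact: cvg_id|exact: cvg_cst].
  have := yv _ fo; apply: (@filterS _ (nbhs v)) => y /=.
  by rewrite !fctE /= subrKC fv opprD addrA.
have oB : metric_open hd (ball v r%:num).
  apply/B1_topology; last exact: ball_open.
  by move=> y /subset_closed_ball /rP[].
have [e2 e2_0 e2B] := metric_open_ball Vv oB (ballxx _ [gt0 of r%:num]).
have [e3 e3_0 e3G] := metric_open_ball Vv G_open Gv.
pose D := d v w.
have D0 : 0 < D.
  rewrite lt_neqAle (metric_on_ge0 hd)// andbT eq_sym.
  by apply/eqP => /(d1 _ _ Vv Vw)/esym.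
(* Within [d]-distance [rho] of [v], a point of [V] satisfies the norm comparison ([e1]), lies in
   the norm ball ([e2]) and lies in [G] ([e3]). *)
pose rho := Num.min e1 (Num.min e2 e3).
have rho0 : 0 < rho by rewrite !lt_min e1_0 e2_0 e3_0.
pose s := Num.min 2^-1 (rho / 2 / D).
have s0 : 0 < s by rewrite lt_min !divr_gt0// invr_gt0 ltr0n.
have s1 : s < 1 by rewrite gt_min; apply/orP; left; lra.
have sD0 : 0 < s * D by exact: mulr_gt0.
have sDrho : s * D < rho.
  have : s * D <= rho / 2 by rewrite -ler_pdivlMr// ge_min lexx orbT.
  lra.
have [p [Vp pv pw]] := B3 w s Vw (introT andP (conj s0 s1)).
pose C := metric_cball V d v (s * D) `&` metric_cball V d w ((1 - s) * D).
have CV z : C z -> V z by case=> -[].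
have Cdv z : C z -> d v z = s * D.
  move=> [[Vz zv] [_ zw]]; have := dt v z w Vv Vz Vw.
  by rewrite -/D (ds v z)//; lra.
have Crho z : C z -> d v z < rho by move/Cdv => ->.
have CG z : C z -> G z.
  move=> Cz; apply: e3G; first exact: CV.
  by apply: lt_le_trans (Crho _ Cz) _; rewrite /rho !ge_min lexx !orbT.
have Cball z : C z -> ball v r%:num z.
  move=> Cz; apply: e2B; first exact: CV.
  by apply: lt_le_trans (Crho _ Cz) _; rewrite /rho !ge_min lexx !orbT.
have Cd x y : V x -> V y -> d v x < e1 -> d v y < e1 ->
    l^-1 * `|x - y| <= d x y <= l * `|x - y|.
  by move=> Vx Vy vx vy; exact: (dU _ _ (e1U _ Vx vx) (e1U _ Vy vy)).
have Ce1 z : C z -> d v z < e1.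
  by move=> Cz; apply: lt_le_trans (Crho _ Cz) _; rewrite /rho !ge_min lexx.
(* Both centres [v] and [w] are fixed, so the nonexpansive [f] maps each of the two balls, within
   [G], into itself. *)
have fC : {homo f : z / C z}.
  move=> z Cz; have [[Vz zv] [_ zw]] := Cz; have Gz := CG _ Cz.
  split; split=> //; try exact: f_GV.
    by rewrite -fv; apply: le_trans zv; exact: f_nonexp.
  by rewrite -fw; apply: le_trans zw; exact: f_nonexp.
have Cp : C p by split; split=> //; rewrite ?pv ?pw.
have cvC : convex_set C.
  move=> x y k /set_mem[x1 x2] /set_mem[y1 y2]; apply/mem_set; split; apply/set_mem.
    by apply: B2 => //; exact: mem_set.
  by apply: B2 => //; exact: mem_set.
have clC : closed C.
  (* [V] need not be closed in [E]: the closed norm ball keeps points inside [V], where each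
     [d]-ball is cut out by the complement of a norm-open set. *)
  have CE : C = closed_ball v r%:num `&` (~` (V `\` metric_cball V d v (s * D)) `&`
      ~` (V `\` metric_cball V d w ((1 - s) * D))).
    apply/seteqP; split=> z.
      move=> Cz; split; first exact/subset_closed_ball/Cball.
      by case: Cz => C1 C2; split=> -[].
    move=> [/rP[Vz _] [C1 C2]].
    by split; apply: contrapT => nC; [apply: C1|apply: C2].
  rewrite CE; apply: closedI; first exact: closed_ball_closed.
  by apply: closedI; apply: open_closedC; apply/B1_topology;
    [move=> ? []|exact: metric_open_setD_cball|move=> ? []|
     exact: metric_open_setD_cball].
have l0 : 0 < l by rewrite /l; lra.
(* One factor [l] passes from norm to [d] at the images, the other from [d] to norm at [x] and
   [y]. *)
have f_lip x y : C x -> C y -> `|f x - f y| <= l ^+ 2 * `|x - y|.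
  move=> Cx Cy; have [Cfx Cfy] := (fC _ Cx, fC _ Cy).
  have /andP[fxy _] := Cd _ _ (CV _ Cfx) (CV _ Cfy) (Ce1 _ Cfx) (Ce1 _ Cfy).
  have /andP[_ xy] := Cd _ _ (CV _ Cx) (CV _ Cy) (Ce1 _ Cx) (Ce1 _ Cy).
  rewrite expr2 -mulrA -ler_pdivrMl//; apply: le_trans fxy _.
  by apply: le_trans xy; apply: f_nonexp; exact: CG.
have [|||z Cz zE] :=
  lipschitz_almost_fixed_point (t := t) clC cvC fC f_lip _ _ _ Cp.
- by rewrite t0; lra.
- by rewrite exprn_ge0// ltW.
- by rewrite /l; nra.
have Cfz := fC _ Cz.
have zv0 : 0 < `|z - v|.
  rewrite normr_gt0 subr_eq0; apply/eqP => zv.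
  by have := Cdv _ Cz; have [d0 _ _ _] := hd; rewrite zv d0//; lra.
have vE1 : d v v < e1 by have [->] := hd.
have sDz : s * D <= l * `|z - v|.
  have /andP[_] := Cd _ _ (CV _ Cz) Vv (Ce1 _ Cz) vE1.
  by rewrite ds ?(Cdv z)//; exact: CV.
(* Both [f z] and [p] lie on the [d]-sphere of radius [s * D] around [v]. *)
have fzp : `|f z - p| <= l * (2 * (s * D)).
  have /andP[+ _] := Cd _ _ (CV _ Cfz) Vp (Ce1 _ Cfz) (Ce1 _ Cp).
  rewrite ler_pdivrMl// => /le_trans; apply; rewrite ler_pM2l//.
  have := dt _ _ _ (CV _ Cfz) Vv Vp.
  by rewrite (ds (f z) v)// ?(Cdv (f z))// ?(Cdv p)//; [lra|exact: CV].
(* Combining [fzp] with [sDz] gives the factor [2 * l ^ 2], at most 8 since [l <= 2]. *)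
have fzz : `|f z - z| <= 8 * t * `|z - v|.
  rewrite zE normrZ gtr0_norm// [8 * t]mulrC -mulrA ler_pM2l//.
  by apply: le_trans fzp _; rewrite /l in sDz *; nra.
exists (z - v); first by rewrite -normr_gt0.
have [_ /= fzo] := rP _ (subset_closed_ball (Cball _ Cz)).
(* The displacement of [z] under [f], minus the remainder of the expansion at [v]. *)
have -> : h (z - v) - (z - v) = (f z - z) - (f z - v - h (z - v)).
  rewrite !opprB [RHS]addrCA; congr (_ + _).
  by rewrite [RHS]addrC addrA subrK.
apply: le_trans (ler_normB _ _) _.
apply: le_trans (lerD fzz fzo) _.
by rewrite -mulrDl ler_pM2r//; lra.
Qed.
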